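(* Every system in the class $\Upsilon_2$ can be transformed, under a complex Lie point transformation $\mathcal{L}_2:(x,u(x))\mapsto(\chi(x,u),U(x,u))$ with $u=f_1+if_2$, into the system of partial differential equations for two real functions $F_1(\chi_1,\chi_2)$, $F_2(\chi_1,\chi_2)$, where $\chi=\chi_1+i\chi_2$ and $U=F_1+iF_2$, consisting of $$F_{1,\chi_1\chi_1}-F_{1,\chi_2\chi_2}+2F_{2,\chi_1\chi_2}=0,$$ $$F_{2,\chi_1\chi_1}-F_{2,\chi_2\chi_2}-2F_{1,\chi_1\chi_2}=0,$$ together with the Cauchy-Riemann equations $$F_{1,\chi_1}=F_{2,\chi_2},\qquad F_{1,\chi_2}=-F_{2,\chi_1}.$$
   Context: All considerations are local. Primes on $f_1,f_2,u$ denote derivatives with respect to the real variable $x$, and subscripts after a comma denote partial derivatives. Consider systems of two second order ODEs for real functions $f_1(x),f_2(x)$ of the form $$f_1''=A_1f_1'^3-3A_2f_1'^2f_2'-3A_1f_1'f_2'^2+A_2f_2'^3+B_1f_1'^2-2B_2f_1'f_2'-B_1f_2'^2+C_1f_1'-C_2f_2'+D_1,$$ $$f_2''=A_2f_1'^3+3A_1f_1'^2f_2'-3A_2f_1'f_2'^2-A_1f_2'^3+B_2f_1'^2+2B_1f_1'f_2'-B_2f_2'^2+C_2f_1'+C_1f_2'+D_2,$$ where $A_j,B_j,C_j,D_j$ ($j=1,2$) are real functions of $(x,f_1,f_2)$. With $u=f_1+if_2$, such a system corresponds to a scalar complex equation (its base equation) $u''+E_3(x,u)u'^3+E_2(x,u)u'^2+E_1(x,u)u'+E_0(x,u)=0$,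 with $E_3=-(A_1+iA_2)$, $E_2=-(B_1+iB_2)$, $E_1=-(C_1+iC_2)$, $E_0=-(D_1+iD_2)$ complex analytic in $u$ (the right-hand sides of the system satisfy the Cauchy-Riemann equations with respect to $(f_1,f_2)$ and with respect to $(f_1',f_2')$). A complex Lie point transformation is an invertible map $\mathcal{L}_2:(x,u(x))\mapsto(\chi(x,u),U(x,u))$, where $\chi$ and $U$ are complex-valued analytic functions of the real variable $x$ and the complex variable $u$; the new independent variable $\chi$ is allowed to be complex. Write $\chi=\chi_1+i\chi_2$ and $U=F_1+iF_2$, and regard $U$ as a complex function of $\chi$, so that $F_1,F_2$ are real functions of $(\chi_1,\chi_2)$; the derivative with respect to $\chi$ is $\frac{\partial}{\partial\chi}=\frac12\left(\frac{\partial}{\partial\chi_1}-i\frac{\partial}{\partial\chi_2}\right)$. A system of two second order ODEs of the form $$f_1''=A_1f_1'^3-3A_2f_1'^2f_2'-3A_1f_1'f_2'^2+A_2f_2'^3+B_1f_1'^2-2B_2f_1'f_2'-B_1f_2'^2+C_1f_1'-C_2f_2'+D_1,$$ $$f_2''=A_2f_1'^3+3A_1f_1'^2f_2'-3A_2f_1'f_2'^2-A_1f_2'^3+B_2f_1'^2+2B_1f_1'f_2'-B_2f_2'^2+C_2f_1'+C_1f_2'+D_2,$$ with $A_j,B_j,C_j,D_j$ ($j=1,2$) real functions of $(x,f_1,f_2)$ such that $A_1+iA_2$, $B_1+iB_2$, $C_1+iC_2$, $D_1+iD_2$ are complex analytic in $u=f_1+if_2$, is called complex linearizable if its base equation $u''+E_3(x,u)u'^3+E_2(x,u)u'^2+E_1(x,u)u'+E_0(x,u)=0$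 can be mapped to $U''=0$ (prime denoting differentiation with respect to $\chi$) by a complex Lie point transformation. The class $\Upsilon_2$ consists of the complex linearizable systems of two second order ODEs for $f_1,f_2$ that have cubic nonlinearity in the first derivatives (that is, $A_1,A_2$ are not both identically zero) and whose Lie algebra of real Lie point symmetries has dimension $0,1,2,3$ or $4$. *)

(* Defs.v *)
From Stdlib Require Export Reals List.
From Coquelicot Require Export Coquelicot.
Open Scope R_scope.

(* Coquelicot's [C] is [R * R], so the complex number f1 + i f2 is the pair
   (f1, f2).

   Everything is local at a base point (x0, u0) of R * C: data are total
   functions of which only the germ at the base point matters, and "identically
   zero", "linearly independent", etc. are read on germs. *)

Definition near (x0 : R) (u0 : C) (P : R -> C -> Prop) : Prop :=
  locally (x0, u0) (fun q : R * C => P (fst q) (snd q)).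

Record cubic_system : Type := CubicSystem {
  A1 : R -> R -> R -> R;  A2 : R -> R -> R -> R;
  B1 : R -> R -> R -> R;  B2 : R -> R -> R -> R;
  C1 : R -> R -> R -> R;  C2 : R -> R -> R -> R;
  D1 : R -> R -> R -> R;  D2 : R -> R -> R -> R
}.

(* p and q stand for f1' and f2'. *)
Definition rhs1 (S : cubic_system) (x y z p q : R) : R :=
  A1 S x y z * p ^ 3 - 3 * A2 S x y z * p ^ 2 * q
  - 3 * A1 S x y z * p * q ^ 2 + A2 S x y z * q ^ 3
  + B1 S x y z * p ^ 2 - 2 * B2 S x y z * p * q - B1 S x y z * q ^ 2
  + C1 S x y z * p - C2 S x y z * q + D1 S x y z.

Definition rhs2 (S : cubic_system) (x y z p q : R) : R :=
  A2 S x y z * p ^ 3 + 3 * A1 S x y z * p ^ 2 * q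
  - 3 * A2 S x y z * p * q ^ 2 - A1 S x y z * q ^ 3
  + B2 S x y z * p ^ 2 + 2 * B1 S x y z * p * q - B2 S x y z * q ^ 2
  + C2 S x y z * p + C1 S x y z * q + D2 S x y z.

Definition twice_diff (a b : R) (f : R -> R) : Prop :=
  forall x, a < x < b -> ex_derive f x /\ ex_derive (Derive f) x.

Definition solves_system (S : cubic_system) (a b : R) (f1 f2 : R -> R) : Prop :=
  twice_diff a b f1 /\ twice_diff a b f2 /\
  forall x, a < x < b ->
    Derive_n f1 2 x = rhs1 S x (f1 x) (f2 x) (Derive f1 x) (Derive f2 x) /\
    Derive_n f2 2 x = rhs2 S x (f1 x) (f2 x) (Derive f1 x) (Derive f2 x).

Definition complexify (g1 g2 : R -> R -> R -> R) (x : R) (u : C) : C :=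
  (g1 x (fst u) (snd u), g2 x (fst u) (snd u)).

Definition E3 (S : cubic_system) (x : R) (u : C) : C :=
  Copp (complexify (A1 S) (A2 S) x u).
Definition E2 (S : cubic_system) (x : R) (u : C) : C :=
  Copp (complexify (B1 S) (B2 S) x u).
Definition E1 (S : cubic_system) (x : R) (u : C) : C :=
  Copp (complexify (C1 S) (C2 S) x u).
Definition E0 (S : cubic_system) (x : R) (u : C) : C :=
  Copp (complexify (D1 S) (D2 S) x u).

Definition analytic_in_u (g : R -> C -> C) (x : R) (u : C) : Prop :=
  exists (a : nat -> C) (r : posreal), forall w : C,
    Cmod (w - u) < r ->
    is_pseries (K := C_AbsRing) (V := C_NormedModule) a (w - u)%C (g x w).

Definition analytic_coefficients (S : cubic_system) (x0 : R) (u0 : C) : Prop :=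
  near x0 u0 (fun x u =>
    analytic_in_u (complexify (A1 S) (A2 S)) x u /\
    analytic_in_u (complexify (B1 S) (B2 S)) x u /\
    analytic_in_u (complexify (C1 S) (C2 S)) x u /\
    analytic_in_u (complexify (D1 S) (D2 S)) x u).

Definition is_Cderive (u : R -> C) (x : R) (l : C) : Prop :=
  is_derive (K := R_AbsRing) (V := C_R_NormedModule) u x l.

Definition jet_curve (a b : R) (u u' u'' : R -> C) : Prop :=
  forall x, a < x < b -> is_Cderive u x (u' x) /\ is_Cderive u' x (u'' x).

Definition base_equation (S : cubic_system) (a b : R) (u u' u'' : R -> C) : Prop :=
  forall x, a < x < b ->
    (u'' x + E3 S x (u x) * u' x ^ 3 + E2 S x (u x) * u' x ^ 2
     + E1 S x (u x) * u' x + E0 S x (u x) = 0)%C.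

(* Joint analyticity of g at (t0, w0), the first variable being mapped into C
   by [inj]: [RtoC] for a real variable, the identity for a complex one.  The
   bound on the coefficients makes the double series absolutely convergent on
   the polydisc, so summing it by total degree loses nothing. *)
Definition analytic2 {T : Type} (inj : T -> C) (g : T -> C -> C)
    (t0 : T) (w0 : C) : Prop :=
  exists (a : nat -> nat -> C) (r : posreal) (M : R),
    (forall m n : nat, Cmod (a m n) * r ^ (m + n) <= M) /\
    forall (t : T) (w : C),
      Cmod (inj t - inj t0) < r -> Cmod (w - w0) < r ->
      is_series (K := C_AbsRing) (V := C_NormedModule)
        (fun n => sum_n (G := C_AbelianMonoid)
           (fun k => a k (n - k)%nat * (inj t - inj t0) ^ k
                     * (w - w0) ^ (n - k))%C n)
        (g t w).

Record transformation : Type := Transformation {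
  chi : R -> C -> C;
  bigU : R -> C -> C
}.

(* The source R * C has one real dimension less than the target C * C, so
   invertibility means having an analytic left inverse (X, W) defined near the
   image of the base point. *)
Definition complex_Lie_point (L : transformation) (x0 : R) (u0 : C) : Prop :=
  analytic2 RtoC (chi L) x0 u0 /\
  analytic2 RtoC (bigU L) x0 u0 /\
  exists X W : C -> C -> C,
    analytic2 (fun z : C => z) X (chi L x0 u0) (bigU L x0 u0) /\
    analytic2 (fun z : C => z) W (chi L x0 u0) (bigU L x0 u0) /\
    near x0 u0 (fun x u =>
      X (chi L x u) (bigU L x u) = RtoC x /\ W (chi L x u) (bigU L x u) = u).

Definition chi_on (L : transformation) (u : R -> C) (x : R) : C := chi L x (u x).
Definition U_on (L : transformation) (u : R -> C) (x : R) : C := bigU L x (u x).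

(* Along a curve, chi can serve as independent variable where d chi / dx is
   nonzero. *)
Definition regular_curve (L : transformation) (a b : R) (u : R -> C) : Prop :=
  forall x, a < x < b -> exists c : C, c <> 0%C /\ is_Cderive (chi_on L u) x c.

(* d g / d k = (d g / d x) / (d k / d x) at x. *)
Definition is_derive_wrt (k g : R -> C) (x : R) (d : C) : Prop :=
  exists c v : C, c <> 0%C /\ is_Cderive k x c /\ is_Cderive g x v /\
    d = (v / c)%C.

(* V is dU / d chi along the curve. *)
Definition flat_equation (L : transformation) (a b : R) (u : R -> C) : Prop :=
  exists V : R -> C, forall x, a < x < b ->
    is_derive_wrt (chi_on L u) (U_on L u) x (V x) /\
    is_derive_wrt (chi_on L u) V x 0%C.

(* An equation is mapped to another one when the curves solving the first are
   exactly those whose images solve the second. *)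
Definition maps_base_equation_to_flat (L : transformation) (S : cubic_system)
    (x0 : R) (u0 : C) : Prop :=
  exists N : R * C -> Prop, locally (x0, u0) N /\
    forall (a b : R) (u u' u'' : R -> C),
      jet_curve a b u u' u'' ->
      (forall x, a < x < b -> N (x, u x)) ->
      regular_curve L a b u ->
      (base_equation S a b u u' u'' <-> flat_equation L a b u).

Definition complex_linearizable (S : cubic_system) (x0 : R) (u0 : C) : Prop :=
  analytic_coefficients S x0 u0 /\
  exists L : transformation,
    complex_Lie_point L x0 u0 /\ maps_base_equation_to_flat L S x0 u0.

Definition dx3 (g : R -> R -> R -> R) : R -> R -> R -> R :=
  fun x y z => Derive (fun t => g t y z) x.
Definition dy3 (g : R -> R -> R -> R) : R -> R -> R -> R :=
  fun x y z => Derive (fun t => g x t z) y.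
Definition dz3 (g : R -> R -> R -> R) : R -> R -> R -> R :=
  fun x y z => Derive (fun t => g x y t) z.

(* Three-variable analogue of Coquelicot's [ex_diff_n]. *)
Fixpoint ex_diff3_n (g : R -> R -> R -> R) (n : nat) (x y z : R) : Prop :=
  continuous (fun q : R * (R * R) => g (fst q) (fst (snd q)) (snd (snd q)))
    (x, (y, z)) /\
  match n with
  | O => True
  | Datatypes.S m =>
      ex_derive (fun t => g t y z) x /\
      ex_derive (fun t => g x t z) y /\
      ex_derive (fun t => g x y t) z /\
      ex_diff3_n (dx3 g) m x y z /\
      ex_diff3_n (dy3 g) m x y z /\
      ex_diff3_n (dz3 g) m x y z
  end.

Definition smooth_near (g : R -> R -> R -> R) (x0 : R) (u0 : C) : Prop :=
  near x0 u0 (fun x u => forall n, ex_diff3_n g n x (fst u) (snd u)).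

(* xi d/dx + eta1 d/df1 + eta2 d/df2 *)
Record vector_field : Type := VectorField {
  xi : R -> R -> R -> R;
  eta1 : R -> R -> R -> R;
  eta2 : R -> R -> R -> R
}.

(* Functions of (x, f1, f2, f1', f2'). *)
Definition jet_fun : Type := R -> R -> R -> R -> R -> R.

Definition lift (g : R -> R -> R -> R) : jet_fun := fun x y z _ _ => g x y z.

Definition jx (g : jet_fun) : jet_fun :=
  fun x y z p q => Derive (fun t => g t y z p q) x.
Definition jy (g : jet_fun) : jet_fun :=
  fun x y z p q => Derive (fun t => g x t z p q) y.
Definition jz (g : jet_fun) : jet_fun :=
  fun x y z p q => Derive (fun t => g x y t p q) z.
Definition jp (g : jet_fun) : jet_fun :=
  fun x y z p q => Derive (fun t => g x y z t q) p.
Definition jq (g : jet_fun) : jet_fun :=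
  fun x y z p q => Derive (fun t => g x y z p t) q.

(* Total derivative d/dx on the solution manifold of the system, i.e. with
   f1'', f2'' replaced by the right-hand sides. *)
Definition total (S : cubic_system) (g : jet_fun) : jet_fun :=
  fun x y z p q =>
    jx g x y z p q + p * jy g x y z p q + q * jz g x y z p q
    + rhs1 S x y z p q * jp g x y z p q + rhs2 S x y z p q * jq g x y z p q.

Definition prol1_1 (S : cubic_system) (X : vector_field) : jet_fun :=
  fun x y z p q =>
    total S (lift (eta1 X)) x y z p q - p * total S (lift (xi X)) x y z p q.
Definition prol1_2 (S : cubic_system) (X : vector_field) : jet_fun :=
  fun x y z p q =>
    total S (lift (eta2 X)) x y z p q - q * total S (lift (xi X)) x y z p q.

Definition prol2_1 (S : cubic_system) (X : vector_field) : jet_fun :=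
  fun x y z p q =>
    total S (prol1_1 S X) x y z p q
    - rhs1 S x y z p q * total S (lift (xi X)) x y z p q.
Definition prol2_2 (S : cubic_system) (X : vector_field) : jet_fun :=
  fun x y z p q =>
    total S (prol1_2 S X) x y z p q
    - rhs2 S x y z p q * total S (lift (xi X)) x y z p q.

Definition apply_prol1 (S : cubic_system) (X : vector_field) (g : jet_fun)
    : jet_fun :=
  fun x y z p q =>
    xi X x y z * jx g x y z p q
    + eta1 X x y z * jy g x y z p q + eta2 X x y z * jz g x y z p q
    + prol1_1 S X x y z p q * jp g x y z p q
    + prol1_2 S X x y z p q * jq g x y z p q.

(* The second prolongation of X annihilates f1'' - rhs1 and f2'' - rhs2 on the
   solution manifold. *)
Definition symmetry (S : cubic_system) (x0 : R) (u0 : C) (X : vector_field)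
    : Prop :=
  smooth_near (xi X) x0 u0 /\ smooth_near (eta1 X) x0 u0 /\
  smooth_near (eta2 X) x0 u0 /\
  near x0 u0 (fun x u => forall p q : R,
    prol2_1 S X x (fst u) (snd u) p q
      = apply_prol1 S X (rhs1 S) x (fst u) (snd u) p q /\
    prol2_2 S X x (fst u) (snd u) p q
      = apply_prol1 S X (rhs2 S) x (fst u) (snd u) p q).

Definition lincomb (d : nat) (c : nat -> R) (h : nat -> R) : R :=
  fold_right Rplus 0 (map (fun i => c i * h i) (seq 0 d)).

Definition germ_lincomb (d : nat) (c : nat -> R) (X : nat -> vector_field)
    (Y : vector_field) (x0 : R) (u0 : C) : Prop :=
  near x0 u0 (fun x u =>
    xi Y x (fst u) (snd u)
      = lincomb d c (fun i => xi (X i) x (fst u) (snd u)) /\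
    eta1 Y x (fst u) (snd u)
      = lincomb d c (fun i => eta1 (X i) x (fst u) (snd u)) /\
    eta2 Y x (fst u) (snd u)
      = lincomb d c (fun i => eta2 (X i) x (fst u) (snd u))).

Definition zero_field : vector_field :=
  VectorField (fun _ _ _ => 0) (fun _ _ _ => 0) (fun _ _ _ => 0).

(* X 0, ..., X (d - 1) is a basis of the real Lie algebra of germs of point
   symmetries. *)
Definition symmetry_dim (S : cubic_system) (x0 : R) (u0 : C) (d : nat) : Prop :=
  exists X : nat -> vector_field,
    (forall i, (i < d)%nat -> symmetry S x0 u0 (X i)) /\
    (forall c : nat -> R, germ_lincomb d c X zero_field x0 u0 ->
       forall i, (i < d)%nat -> c i = 0) /\
    (forall Y, symmetry S x0 u0 Y ->
       exists c : nat -> R, germ_lincomb d c X Y x0 u0).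

Definition Upsilon2 (S : cubic_system) (x0 : R) (u0 : C) : Prop :=
  complex_linearizable S x0 u0 /\
  ~ near x0 u0 (fun x u =>
      A1 S x (fst u) (snd u) = 0 /\ A2 S x (fst u) (snd u) = 0) /\
  exists d : nat, (d <= 4)%nat /\ symmetry_dim S x0 u0 d.

(* [partial_derive m k F] differentiates m times in the first variable and k
   times in the second; [ex_diff_n F 2] says that F is of class C^2. *)
Definition pde_system (D : C -> Prop) (F1 F2 : R -> R -> R) : Prop :=
  forall s t : R, D (s, t) ->
    ex_diff_n F1 2 s t /\ ex_diff_n F2 2 s t /\
    partial_derive 2 0 F1 s t - partial_derive 0 2 F1 s t
      + 2 * partial_derive 1 1 F2 s t = 0 /\
    partial_derive 2 0 F2 s t - partial_derive 0 2 F2 s t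
      - 2 * partial_derive 1 1 F1 s t = 0 /\
    partial_derive 1 0 F1 s t = partial_derive 0 1 F2 s t /\
    partial_derive 0 1 F1 s t = - partial_derive 1 0 F2 s t.

(* Along the curve u, U is the function F1 + i F2 of chi = chi1 + i chi2. *)
Definition U_as_function_of_chi (L : transformation) (a b : R) (u : R -> C)
    (D : C -> Prop) (F1 F2 : R -> R -> R) : Prop :=
  forall x, a < x < b ->
    D (chi_on L u x) /\
    U_on L u x = (F1 (fst (chi_on L u x)) (snd (chi_on L u x)),
                  F2 (fst (chi_on L u x)) (snd (chi_on L u x))).

Definition transforms_system_to_pde (L : transformation) (S : cubic_system)
    (x0 : R) (u0 : C) : Prop :=
  exists N : R * C -> Prop, locally (x0, u0) N /\
    forall (a b : R) (f1 f2 : R -> R),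
      twice_diff a b f1 -> twice_diff a b f2 ->
      (forall x, a < x < b -> N (x, (f1 x, f2 x))) ->
      regular_curve L a b (fun x => (f1 x, f2 x)) ->
      (solves_system S a b f1 f2 <->
       exists (D : C -> Prop) (F1 F2 : R -> R -> R),
         open D /\ pde_system D F1 F2 /\
         U_as_function_of_chi L a b (fun x => (f1 x, f2 x)) D F1 F2).

(* Main.v *)
Require Import Defs.
From Stdlib Require Import Lra.

(** The transformation that linearizes the base equation also works for the
    system of partial differential equations: both u'' + ... = 0 read as a
    system and U'' = 0 read as a system are only the real and imaginary parts
    of the scalar complex equations.

    On the source side, writing u = f1 + i f2 and separating real and imaginary
    parts identifies the solutions (f1, f2) of the system with the solutions u
    of the base equation ([solves_system_base_equation]), and by hypothesis,
    near the base point and among curves with d chi / dx nonzero, these are the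
    curves along which d^2 U / d chi^2 = 0.

    On the target side, one has to see that d^2 U / d chi^2 = 0 along a curve
    says exactly that U = F1 + i F2 is there the restriction of a solution
    (F1, F2) of the system of partial differential equations
    ([flat_equation_pde_system]).
    - Since x is real, U'' = 0 integrates along the curve to U = m chi + k with
      complex constants m and k ([flat_equation_affine]), and the real and
      imaginary parts of m chi + k solve the system on the whole plane
      ([pde_system_affine]).
    - Conversely, the Cauchy-Riemann equations turn the two second order
      equations into 4 F_{1,chi1 chi1} = 0 and 4 F_{2,chi1 chi1} = 0, so that
      F1 and F2 have zero Hessian ([pde_system_hessian_zero]).  Then
      G = F1 + i F2 is holomorphic with locally constant derivative, and the
      chain rule gives dU / d chi = G'(chi), of derivative zero along the
      curve ([pde_system_flat]). *)

(** * Complex-valued functions of a real variable *)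

Lemma is_Cderive_pair (u : R -> C) (x : R) (l : C) :
  is_Cderive u x l <->
  is_derive (fun t => fst (u t)) x (fst l) /\
  is_derive (fun t => snd (u t)) x (snd l).
Proof.
  unfold is_Cderive, is_derive; split.
  - intros Hu; split.
    + apply (filterdiff_comp (K := R_AbsRing) (U := R_NormedModule)
               (V := C_R_NormedModule) (W := R_NormedModule)
               u (fun t : C => fst t) _ (fun t : C => fst t) Hu).
      apply filterdiff_linear, (is_linear_fst (U := R_NormedModule)).
    + apply (filterdiff_comp (K := R_AbsRing) (U := R_NormedModule)
               (V := C_R_NormedModule) (W := R_NormedModule)
               u (fun t : C => snd t) _ (fun t : C => snd t) Hu).
      apply filterdiff_linear, (is_linear_snd (V := R_NormedModule)).
  - intros [H1 H2].
    apply (filterdiff_ext (K := R_AbsRing) (U := R_NormedModule)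
             (V := C_R_NormedModule)
             (fun t => (fst (u t), snd (u t)))).
    { intros t; symmetry; apply surjective_pairing. }
    apply (filterdiff_comp_2 (K := R_AbsRing) (T := R_NormedModule)
             (U := R_NormedModule) (V := R_NormedModule)
             (W := C_R_NormedModule)
             (fun t => fst (u t)) (fun t => snd (u t)) pair
             (fun y => scal y (fst l)) (fun y => scal y (snd l)) pair H1 H2).
    apply (filterdiff_ext_lin (K := R_AbsRing)
             (U := prod_NormedModule R_AbsRing R_NormedModule R_NormedModule)
             (V := C_R_NormedModule) _ (fun t => t)).
    + apply (filterdiff_ext (K := R_AbsRing)
               (U := prod_NormedModule R_AbsRing R_NormedModule R_NormedModule)
               (V := C_R_NormedModule) (fun t => t)).
      { intros t; apply surjective_pairing. }
      apply filterdiff_id.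
    + intros t; apply surjective_pairing.
Qed.

Lemma is_Cderive_zero_const (a b : R) (g : R -> C) :
  (forall x, a < x < b -> is_Cderive g x 0%C) ->
  forall x y, a < x < b -> a < y < b -> g x = g y.
Proof.
  intros Hg.
  assert (H : forall x y, a < x < b -> a < y < b -> x < y -> g x = g y).
  { intros x y Hx Hy Hxy.
    apply (eq_is_derive (V := C_R_NormedModule) g x y); [| exact Hxy].
    intros t Ht; apply Hg; lra. }
  intros x y Hx Hy.
  destruct (Rtotal_order x y) as [Hlt | [-> | Hgt]].
  - now apply H.
  - reflexivity.
  - symmetry; now apply H.
Qed.

Lemma is_Cderive_sub_mul (m c v : C) (k g : R -> C) (x : R) :
  is_Cderive k x c -> is_Cderive g x v ->
  is_Cderive (fun t => g t - m * k t)%C x (v - m * c)%C.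
Proof.
  rewrite !is_Cderive_pair; cbn; intros [Hk1 Hk2] [Hg1 Hg2].
  split.
  - apply (is_derive_plus (fun t => fst (g t))); [exact Hg1 |].
    apply (is_derive_opp (fun t => fst m * fst (k t) - snd m * snd (k t))).
    apply (is_derive_minus (fun t => fst m * fst (k t)));
      apply is_derive_scal; assumption.
  - apply (is_derive_plus (fun t => snd (g t))); [exact Hg2 |].
    apply (is_derive_opp (fun t => fst m * snd (k t) + snd m * fst (k t))).
    apply (is_derive_plus (fun t => fst m * snd (k t)));
      apply is_derive_scal; assumption.
Qed.

(** * Consequences of the system of partial differential equations *)

(** Partial derivatives alone do not give the chain rule: continuity of the
    first one near the point is what makes f differentiable there. *)
Lemma is_derive_comp_2d (f : R -> R -> R) (g h : R -> R) (x dg dh : R) :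
  locally (g x, h x) (fun q : R * R => ex_diff_n f 1 (fst q) (snd q)) ->
  is_derive g x dg -> is_derive h x dh ->
  is_derive (fun t => f (g t) (h t)) x
    (Derive (fun z => f z (h x)) (g x) * dg
     + Derive (fun z => f (g x) z) (h x) * dh).
Proof.
  intros Hf Hg Hh.
  apply is_derive_Reals, derivable_pt_lim_comp_2d;
    [| now apply is_derive_Reals | now apply is_derive_Reals].
  apply filterdiff_differentiable_pt_lim.
  apply (is_derive_filterdiff f (g x) (h x)
           (fun u v => Derive (fun z => f z v) u)).
  - revert Hf; apply filter_imp; intros [s t] (_ & Hs & _).
    now apply Derive_correct.
  - apply locally_singleton in Hf; destruct Hf as (_ & _ & Ht & _).
    now apply Derive_correct.
  - apply locally_singleton in Hf; destruct Hf as (_ & _ & _ & [Hc _] & _).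
    now apply continuity_2d_pt_filterlim in Hc.
Qed.

Lemma Schwarz_C2 (D : C -> Prop) (F : R -> R -> R) (s t : R) :
  open D -> (forall s t, D (s, t) -> ex_diff_n F 2 s t) -> D (s, t) ->
  Derive (fun z => Derive (fun w => F z w) t) s
  = Derive (fun z => Derive (fun w => F w z) s) t.
Proof.
  intros HD HF Hst.
  apply Schwarz.
  - apply locally_2d_locally.
    generalize (HD _ Hst); apply filter_imp; intros [u v] Huv.
    destruct (HF _ _ Huv) as (_ & H1 & H2 & (_ & _ & H3 & _) & (_ & H4 & _)).
    now repeat split.
  - apply (HF _ _ Hst).
  - apply (HF _ _ Hst).
Qed.

Lemma Derive_eq_on_open (D : C -> Prop) (f g : R -> R -> R) (s t : R) :
  open D -> (forall s t, D (s, t) -> f s t = g s t) -> D (s, t) ->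
  Derive (fun z => f z t) s = Derive (fun z => g z t) s /\
  Derive (fun z => f s z) t = Derive (fun z => g s z) t.
Proof.
  intros HD Hfg Hst.
  destruct (proj2 (locally_2d_locally (fun u v => D (u, v)) s t)) as [e He].
  { generalize (HD _ Hst); apply filter_imp; now intros []. }
  split; apply Derive_ext_loc; exists e; intros z Hz; apply Hfg, He;
    try exact Hz; rewrite Rminus_diag, Rabs_R0; apply cond_pos.
Qed.

(** Differentiating the Cauchy-Riemann equations and using the symmetry of the
    mixed derivatives expresses the Hessians of F1 and F2 by a := F_{1,11} and
    b := F_{2,11} alone: F_{1,22} = -a, F_{2,12} = a, F_{2,22} = -b and
    F_{1,12} = -b.  The two second order equations become 4 a = 0 and
    4 b = 0. *)
Lemma pde_system_hessian_zero (D : C -> Prop) (F1 F2 : R -> R -> R) (s t : R) :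
  open D -> pde_system D F1 F2 -> D (s, t) ->
  Derive (fun z => Derive (fun w => F1 w t) z) s = 0 /\
  Derive (fun z => Derive (fun w => F1 w z) s) t = 0 /\
  Derive (fun z => Derive (fun w => F2 w t) z) s = 0 /\
  Derive (fun z => Derive (fun w => F2 w z) s) t = 0.
Proof.
  intros HD HP Hst.
  assert (HF1 : forall s t, D (s, t) -> ex_diff_n F1 2 s t)
    by (intros p q H; apply (HP _ _ H)).
  assert (HF2 : forall s t, D (s, t) -> ex_diff_n F2 2 s t)
    by (intros p q H; apply (HP _ _ H)).
  assert (CR1 : forall s t, D (s, t) ->
             Derive (fun w => F1 w t) s = Derive (fun w => F2 s w) t)
    by (intros p q H; apply (HP _ _ H)).
  assert (CR2 : forall s t, D (s, t) ->
             Derive (fun w => F1 s w) t = - Derive (fun w => F2 w t) s)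
    by (intros p q H; apply (HP _ _ H)).
  pose proof (Schwarz_C2 D F1 s t HD HF1 Hst) as S1.
  pose proof (Schwarz_C2 D F2 s t HD HF2 Hst) as S2.
  destruct (Derive_eq_on_open D _ _ s t HD CR1 Hst) as [X1 Y1].
  destruct (Derive_eq_on_open D _ _ s t HD CR2 Hst) as [X2 Y2].
  rewrite Derive_opp in X2, Y2.
  (* Eta-expands the inner derivative, as it stands in the other equations. *)
  change (Derive (fun z => Derive (fun w => F1 z w) t) s
          = - Derive (fun z => Derive (fun w => F2 w t) z) s) in X2.
  destruct (HP _ _ Hst) as (_ & _ & P1 & P2 & _ & _).
  change (Derive (fun z => Derive (fun w => F1 w t) z) s
          - Derive (fun z => Derive (fun w => F1 s w) z) t
          + 2 * Derive (fun z => Derive (fun w => F2 z w) t) s = 0) in P1.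
  change (Derive (fun z => Derive (fun w => F2 w t) z) s
          - Derive (fun z => Derive (fun w => F2 s w) z) t
          - 2 * Derive (fun z => Derive (fun w => F1 z w) t) s = 0) in P2.
  repeat split; lra.
Qed.

(** * Affine solutions *)

Lemma ex_diff_n_const (c : R) (n : nat) (s t : R) :
  ex_diff_n (fun _ _ => c) n s t.
Proof.
  revert c; induction n as [| n IH]; intros c.
  - split; [apply continuity_2d_pt_const | exact I].
  - split; [apply continuity_2d_pt_const |].
    split; [apply ex_derive_const |]; split; [apply ex_derive_const |].
    split; apply (ex_diff_n_ext_loc (fun _ _ => 0)); try apply IH;
      apply locally_2d_forall; intros u v; now rewrite Derive_const.
Qed.

Lemma Derive_affine_1 (p q r s t : R) :
  Derive (fun w => p * w + q * t + r) s = p.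
Proof. apply is_derive_unique; auto_derive; [exact I | ring]. Qed.

Lemma Derive_affine_2 (p q r s t : R) :
  Derive (fun w => p * s + q * w + r) t = q.
Proof. apply is_derive_unique; auto_derive; [exact I | ring]. Qed.

Lemma ex_diff_n_affine (p q r : R) (n : nat) (s t : R) :
  ex_diff_n (fun u v => p * u + q * v + r) n s t.
Proof.
  assert (Hc : continuity_2d_pt (fun u v => p * u + q * v + r) s t).
  { repeat first [ apply continuity_2d_pt_plus | apply continuity_2d_pt_mult
                 | apply continuity_2d_pt_const | apply continuity_2d_pt_id1
                 | apply continuity_2d_pt_id2 ]. }
  destruct n as [| n]; split; try exact Hc; [exact I |].
  split; [auto_derive; exact I |]; split; [auto_derive; exact I |].
  split.
  - apply (ex_diff_n_ext_loc (fun _ _ => p)); [| apply ex_diff_n_const].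
    apply locally_2d_forall; intros u v; now rewrite Derive_affine_1.
  - apply (ex_diff_n_ext_loc (fun _ _ => q)); [| apply ex_diff_n_const].
    apply locally_2d_forall; intros u v; now rewrite Derive_affine_2.
Qed.

(** The two functions are the real and imaginary parts of m chi + k at
    chi = s + i t. *)
Lemma pde_system_affine (D : C -> Prop) (m k : C) :
  pde_system D
    (fun s t => fst m * s + - snd m * t + fst k)
    (fun s t => snd m * s + fst m * t + snd k).
Proof.
  intros s t _.
  assert (H20 : forall p q r,
    partial_derive 2 0 (fun s t => p * s + q * t + r) s t = 0).
  { intros p q r; unfold partial_derive; cbn.
    rewrite (Derive_ext _ (fun _ => p)); [apply Derive_const |].
    intros; apply Derive_affine_1. }
  assert (H02 : forall p q r,
    partial_derive 0 2 (fun s t => p * s + q * t + r) s t = 0).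
  { intros p q r; unfold partial_derive; cbn.
    rewrite (Derive_ext _ (fun _ => q)); [apply Derive_const |].
    intros; apply Derive_affine_2. }
  assert (H11 : forall p q r,
    partial_derive 1 1 (fun s t => p * s + q * t + r) s t = 0).
  { intros p q r; unfold partial_derive; cbn.
    rewrite (Derive_ext _ (fun _ => q)); [apply Derive_const |].
    intros; apply Derive_affine_2. }
  split; [apply ex_diff_n_affine |]; split; [apply ex_diff_n_affine |].
  rewrite !H20, !H02, !H11.
  unfold partial_derive; cbn.
  rewrite !Derive_affine_1, !Derive_affine_2.
  repeat split; ring.
Qed.

(** * The flat equation along a curve *)

(** Dividing by the nonzero d chi / dx does not change where a derivative
    vanishes: V = dU / d chi has zero x-derivative, hence is a constant m, and
    then so has U - m chi. *)
Lemma flat_equation_affine (L : transformation) (a b : R) (u : R -> C) :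
  flat_equation L a b u ->
  exists m k : C, forall x, a < x < b ->
    U_on L u x = (m * chi_on L u x + k)%C.
Proof.
  intros [V HV].
  assert (HV0 : forall x, a < x < b -> is_Cderive V x 0%C).
  { intros x Hx; destruct (HV x Hx) as [_ (c & v & Hc & _ & Hv & E)].
    assert (Ev : v = (v / c * c)%C) by (field; exact Hc).
    rewrite <- E, Cmult_0_l in Ev; now rewrite <- Ev. }
  (* The constants are read at the midpoint; if the interval is empty, there is
     nothing to prove about them. *)
  set (x0 := (a + b) / 2).
  exists (V x0), (U_on L u x0 - V x0 * chi_on L u x0)%C.
  intros x Hx.
  assert (Hx0 : a < x0 < b) by (unfold x0; lra).
  enough (E : (U_on L u x - V x0 * chi_on L u x
               = U_on L u x0 - V x0 * chi_on L u x0)%C)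
    by (rewrite <- E; ring).
  apply (is_Cderive_zero_const a b
           (fun t => U_on L u t - V x0 * chi_on L u t)%C); try assumption.
  intros y Hy; destruct (HV y Hy) as [(c & v & Hc & Hk & Hg & E) _].
  assert (Ev : (v - V x0 * c = 0)%C).
  { rewrite <- (is_Cderive_zero_const a b V HV0 y x0 Hy Hx0), E.
    field; exact Hc. }
  rewrite <- Ev; now apply is_Cderive_sub_mul.
Qed.

(** By the Cauchy-Riemann equations, the chain rule for F1 + i F2 is
    multiplication of d chi / dx by the complex derivative
    F_{1,chi1} + i F_{2,chi1}; so the latter, taken along the curve, is
    dU / d chi.  It has zero derivative because the Hessians vanish. *)
Lemma pde_system_flat (L : transformation) (a b : R) (u : R -> C)
    (D : C -> Prop) (F1 F2 : R -> R -> R) :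
  regular_curve L a b u -> open D -> pde_system D F1 F2 ->
  U_as_function_of_chi L a b u D F1 F2 ->
  flat_equation L a b u.
Proof.
  intros Hreg HD HP HU.
  exists (fun x => (Derive (fun z => F1 z (snd (chi_on L u x))) (fst (chi_on L u x)),
                    Derive (fun z => F2 z (snd (chi_on L u x))) (fst (chi_on L u x)))).
  intros x Hx.
  destruct (Hreg x Hx) as (c & Hc & Hk).
  pose proof Hk as Hk'; apply is_Cderive_pair in Hk' as [Hk1 Hk2].
  destruct (HU x Hx) as [HDx _].
  revert HDx Hk1 Hk2.
  set (g := fun t => fst (chi_on L u t)).
  set (h := fun t => snd (chi_on L u t)).
  intros HDx Hk1 Hk2.
  assert (HDx' : D (g x, h x)) by (unfold g, h; now rewrite <- surjective_pairing).
  assert (near2 : forall Q : R -> R -> Prop, (forall s t, D (s, t) -> Q s t) ->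
            locally (g x, h x) (fun q : R * R => Q (fst q) (snd q))).
  { intros Q HQ; generalize (HD _ HDx'); apply filter_imp.
    intros [s t] Hst; now apply HQ. }
  split.
  - exists c, ((Derive (fun z => F1 z (h x)) (g x),
                Derive (fun z => F2 z (h x)) (g x)) * c)%C.
    assert (Hdiv : forall d : C, d = (d * c / c)%C)
      by (intros; field; exact Hc).
    split; [exact Hc |]; split; [exact Hk |]; split; [| apply Hdiv].
    destruct (HP _ _ HDx') as (_ & _ & _ & _ & CR1 & CR2).
    unfold partial_derive, Derive_n in CR1, CR2.
    assert (Hloc : locally x (fun t : R => U_on L u t = (F1 (g t) (h t), F2 (g t) (h t)))).
    { assert (O : open (fun t : R => a < t < b))
        by (apply open_and; [apply open_gt | apply open_lt]).
      generalize (O x Hx); apply filter_imp; intros t Ht; apply (HU t Ht). }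
    apply is_Cderive_pair; split.
    + apply (is_derive_ext_loc (fun t => F1 (g t) (h t))).
      { revert Hloc; apply filter_imp; intros t Ht; now rewrite Ht. }
      replace (fst _) with
        (Derive (fun z => F1 z (h x)) (g x) * fst c
         + Derive (fun z => F1 (g x) z) (h x) * snd c)
        by (cbn; rewrite CR2; ring).
      apply is_derive_comp_2d; try assumption.
      apply near2; intros s t Hst.
      apply (ex_diff_n_m 2); [now repeat constructor | apply (HP _ _ Hst)].
    + apply (is_derive_ext_loc (fun t => F2 (g t) (h t))).
      { revert Hloc; apply filter_imp; intros t Ht; now rewrite Ht. }
      replace (snd _) with
        (Derive (fun z => F2 z (h x)) (g x) * fst c
         + Derive (fun z => F2 (g x) z) (h x) * snd c)
        by (cbn; rewrite CR1; ring).
      apply is_derive_comp_2d; try assumption.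
      apply near2; intros s t Hst.
      apply (ex_diff_n_m 2); [now repeat constructor | apply (HP _ _ Hst)].
  - exists c, 0%C.
    split; [exact Hc |]; split; [exact Hk |]; split; [| field; exact Hc].
    destruct (pde_system_hessian_zero D F1 F2 _ _ HD HP HDx')
      as (E1 & E2 & E3 & E4).
    apply is_Cderive_pair; cbn; split.
    + replace 0 with
        (Derive (fun z => Derive (fun w => F1 w (h x)) z) (g x) * fst c
         + Derive (fun z => Derive (fun w => F1 w z) (g x)) (h x) * snd c)
        by (rewrite E1, E2; ring).
      apply (is_derive_comp_2d (fun s t => Derive (fun z => F1 z t) s) g h);
        try assumption.
      apply near2; intros s t Hst; apply ex_diff_n_deriv_aux1, (HP _ _ Hst).
    + replace 0 with
        (Derive (fun z => Derive (fun w => F2 w (h x)) z) (g x) * fst c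
         + Derive (fun z => Derive (fun w => F2 w z) (g x)) (h x) * snd c)
        by (rewrite E3, E4; ring).
      apply (is_derive_comp_2d (fun s t => Derive (fun z => F2 z t) s) g h);
        try assumption.
      apply near2; intros s t Hst; apply ex_diff_n_deriv_aux1, (HP _ _ Hst).
Qed.

Lemma flat_equation_pde_system (L : transformation) (a b : R) (u : R -> C) :
  regular_curve L a b u ->
  flat_equation L a b u <->
  exists (D : C -> Prop) (F1 F2 : R -> R -> R),
    open D /\ pde_system D F1 F2 /\ U_as_function_of_chi L a b u D F1 F2.
Proof.
  intros Hreg; split.
  - intros Hflat; destruct (flat_equation_affine L a b u Hflat) as (m & k & E).
    eexists (fun _ => True), _, _.
    split; [apply open_true |].
    split; [apply (pde_system_affine _ m k) |].
    intros x Hx; split; [exact I |].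
    rewrite (E x Hx); apply injective_projections; cbn; ring.
  - intros (D & F1 & F2 & HD & HP & HU).
    now apply (pde_system_flat L a b u D F1 F2).
Qed.

(** * The system as real and imaginary parts of the base equation *)

Lemma twice_diff_jet_curve (a b : R) (f1 f2 : R -> R) :
  twice_diff a b f1 -> twice_diff a b f2 ->
  jet_curve a b (fun x => (f1 x, f2 x))
    (fun x => (Derive f1 x, Derive f2 x))
    (fun x => (Derive_n f1 2 x, Derive_n f2 2 x)).
Proof.
  intros H1 H2 x Hx; destruct (H1 x Hx), (H2 x Hx).
  rewrite !is_Cderive_pair; cbn.
  repeat split; now apply Derive_correct.
Qed.

Lemma solves_system_base_equation (S : cubic_system) (a b : R) (f1 f2 : R -> R) :
  twice_diff a b f1 -> twice_diff a b f2 ->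
  solves_system S a b f1 f2 <->
  base_equation S a b (fun x => (f1 x, f2 x))
    (fun x => (Derive f1 x, Derive f2 x))
    (fun x => (Derive_n f1 2 x, Derive_n f2 2 x)).
Proof.
  intros H1 H2.
  (* The cubic forms in f1', f2' are those of the real and imaginary parts of
     A u'^3 + B u'^2 + C u' + D. *)
  assert (Hsplit : forall x p q v w,
    ((v, w) + E3 S x (f1 x, f2 x) * (p, q) ^ 3
     + E2 S x (f1 x, f2 x) * (p, q) ^ 2
     + E1 S x (f1 x, f2 x) * (p, q) + E0 S x (f1 x, f2 x))%C
    = (v - rhs1 S x (f1 x) (f2 x) p q, w - rhs2 S x (f1 x) (f2 x) p q)).
  { intros; apply injective_projections; cbn; unfold rhs1, rhs2; cbn; ring. }
  unfold solves_system, base_equation; split.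
  - intros (_ & _ & H) x Hx; destruct (H x Hx) as [K1 K2].
    rewrite Hsplit, K1, K2; apply injective_projections; cbn [fst snd RtoC]; ring.
  - intros H; split; [exact H1 |]; split; [exact H2 |].
    intros x Hx; specialize (H x Hx); rewrite Hsplit in H.
    injection H as K1 K2; split; now apply Rminus_diag_uniq.
Qed.

Theorem theorem1 (S : cubic_system) (x0 : R) (u0 : C) :
  Upsilon2 S x0 u0 ->
  exists L : transformation,
    complex_Lie_point L x0 u0 /\ transforms_system_to_pde L S x0 u0.
Proof.
  intros ((_ & L & HL & N & HN & Hmap) & _).
  exists L; split; [exact HL |].
  exists N; split; [exact HN |].
  intros a b f1 f2 H1 H2 HNf Hreg.
  rewrite solves_system_base_equation by assumption.
  rewrite <- flat_equation_pde_system by assumption.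
  apply Hmap; try assumption.
  now apply twice_diff_jet_curve.
Qed.
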